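(* Let $X$ be a strictly convex normed space with $\dim X\geq 2$ and let $Y$ be a normed space that is not strictly convex. Then a graph $G$ is $(X,Y)$-flattenable if and only if it contains no $K_4$ minor.
   Context: All normed spaces are real and have dimension greater than zero, and may be infinite-dimensional. A normed space $X$ is strictly convex if for all $x,y\in X$ with $\|x\|=\|y\|=1$, we have $\|x+y\|=2$ if and only if $x=y$. A graph $G=(V,E)$ is finite and simple with at least one edge. The measurement map of $(G,X)$ is $f_{G,X}:X^V\to\mathbb{R}^E$, $(x_v)_{v\in V}\mapsto(\|x_v-x_w\|_X)_{vw\in E}$. The graph $G$ is $(X,Y)$-flattenable if $f_{G,X}(X^V)\supseteq f_{G,Y}(Y^V)$. $K_4$ is the complete graph on 4 vertices. A minor of a graph is any graph obtained from it by a sequence of edge deletions, edge contractions and deletions of isolated vertices. *)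

(* Defs.v *)
From HB Require Import structures.
From mathcomp Require Import all_boot all_order all_algebra.
From mathcomp Require Import all_classical all_reals all_analysis.
Set Implicit Arguments.
Unset Strict Implicit.
Unset Printing Implicit Defensive.
Import Order.TTheory GRing.Theory Num.Theory.
Import numFieldNormedType.Exports.
Local Open Scope classical_set_scope.
Local Open Scope ring_scope.

(* The dimension may be infinite: [dim_ge n X] asks for n linearly independent
   vectors. *)
Definition dim_ge (R : realType) (n : nat) (X : normedModType R) : Prop :=
  exists b : 'I_n -> X, forall c : 'I_n -> R,
    \sum_(i < n) c i *: b i = 0 -> forall i, c i = 0.

Definition strictly_convex (R : realType) (X : normedModType R) : Prop :=
  forall x y : X, `|x| = 1 -> `|y| = 1 -> (`|x + y| = 2 <-> x = y).

Record sgraph := SGraph {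
  vertex :> finType;
  adj : rel vertex;
  adj_sym : symmetric adj;
  adj_irrefl : irreflexive adj }.

Definition has_edge (G : sgraph) : Prop := exists u v : G, adj u v.

Definition is_edge (G : sgraph) (e : {set G}) : bool :=
  [exists uv : G * G, adj uv.1 uv.2 && (e == [set uv.1; uv.2]%SET)].

Definition edge (G : sgraph) := {e : {set G} | is_edge e}.

(* An arbitrary orientation of each edge; [measurementE] shows that the
   measurement map does not depend on it. *)
Definition endpoints (G : sgraph) (e : edge G) : G * G :=
  xchoose (existsP (valP e)).

Definition measurement (R : realType) (G : sgraph) (X : normedModType R)
    (x : G -> X) : edge G -> R :=
  fun e => `|x (endpoints e).1 - x (endpoints e).2|.

Definition flattenable (R : realType) (X Y : normedModType R)
    (G : sgraph) : Prop :=
  range (@measurement R G Y) `<=` range (@measurement R G X).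

Lemma is_edge_adj (G : sgraph) (u v : G) : adj u v -> is_edge [set u; v]%SET.
Proof. by move=> uv; apply/existsP; exists (u, v); rewrite /= uv eqxx. Qed.

Definition mk_edge (G : sgraph) (u v : G) (uv : adj u v) : edge G :=
  exist _ [set u; v]%SET (is_edge_adj uv).

Lemma measurementE (R : realType) (G : sgraph) (X : normedModType R)
    (x : G -> X) (u v : G) (uv : adj u v) :
  measurement x (mk_edge uv) = `|x u - x v|.
Proof.
rewrite /measurement /endpoints; move: (xchooseP (existsP (valP (mk_edge uv)))).
case: (xchoose _) => a b /= /andP[ab /eqP E].
have : a \in [set u; v]%SET by rewrite E set21.
have : b \in [set u; v]%SET by rewrite E set22.
rewrite !inE => /orP[] /eqP eb /orP[] /eqP ea; subst a b => //.
- by rewrite adj_irrefl in ab.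
- by rewrite distrC.
- by rewrite adj_irrefl in ab.
Qed.

Section MinorOperations.
Variable G : sgraph.

Section DeleteEdge.
Variables x y : G.

Definition del_edge_adj : rel G := fun u v =>
  adj u v && ([set u; v]%SET != [set x; y]%SET).

Lemma del_edge_sym : symmetric del_edge_adj.
Proof. by move=> u v; rewrite /del_edge_adj adj_sym finset.setUC. Qed.

Lemma del_edge_irrefl : irreflexive del_edge_adj.
Proof. by move=> u; rewrite /del_edge_adj adj_irrefl. Qed.

Definition del_edge := SGraph del_edge_sym del_edge_irrefl.
End DeleteEdge.

Section DeleteVertex.
Variable x : G.

Definition del_vertex_adj : rel {u : G | u != x} := fun u v =>
  adj (val u) (val v).

Lemma del_vertex_sym : symmetric del_vertex_adj.
Proof. by move=> u v; rewrite /del_vertex_adj adj_sym. Qed.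

Lemma del_vertex_irrefl : irreflexive del_vertex_adj.
Proof. by move=> u; rewrite /del_vertex_adj adj_irrefl. Qed.

Definition del_vertex := SGraph del_vertex_sym del_vertex_irrefl.
End DeleteVertex.

(* y is removed and x, standing for the merged vertex, inherits its neighbours;
   loops and parallel edges are discarded. *)
Section Contract.
Variables x y : G.

Definition contract_adj : rel {u : G | u != y} := fun u v =>
  (u != v) && [|| adj (val u) (val v),
                  (val u == x) && adj y (val v)
                | (val v == x) && adj (val u) y].

Lemma contract_sym : symmetric contract_adj.
Proof.
move=> u v; rewrite /contract_adj eq_sym (adj_sym (val u) (val v)).
by rewrite (adj_sym y) (adj_sym (val u) y); do !bool_congr.
Qed.

Lemma contract_irrefl : irreflexive contract_adj.
Proof. by move=> u; rewrite /contract_adj eqxx. Qed.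

Definition contract := SGraph contract_sym contract_irrefl.
End Contract.

End MinorOperations.

Inductive reduces : sgraph -> sgraph -> Prop :=
| reduces_refl (G : sgraph) : reduces G G
| reduces_del_edge (G H : sgraph) (x y : G) :
    adj x y -> reduces (del_edge x y) H -> reduces G H
| reduces_contract (G H : sgraph) (x y : G) :
    adj x y -> reduces (contract x y) H -> reduces G H
| reduces_del_isolated (G H : sgraph) (x : G) :
    (forall u : G, ~~ adj x u) -> reduces (del_vertex x) H -> reduces G H.

Definition isomorphic (G H : sgraph) : Prop :=
  exists2 f : G -> H, bijective f & forall u v, adj (f u) (f v) = adj u v.

Definition has_minor (G H : sgraph) : Prop :=
  exists2 K : sgraph, reduces G K & isomorphic K H.

Section Complete.
Variable n : nat.

Definition complete_adj : rel 'I_n := fun u v => u != v.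

Lemma complete_sym : symmetric complete_adj.
Proof. by move=> u v; rewrite /complete_adj eq_sym. Qed.

Lemma complete_irrefl : irreflexive complete_adj.
Proof. by move=> u; rewrite /complete_adj eqxx. Qed.

Definition complete := SGraph complete_sym complete_irrefl.
End Complete.

(* Main.v *)
Require Import Defs.
From HB Require Import structures.
From mathcomp Require Import all_boot all_order all_algebra.
From mathcomp Require Import all_classical all_reals all_analysis.
From mathcomp Require Import finset zify lra ring.
(* Makes [contract] edge contraction again, not the map on extended reals. *)
Require Import Defs.

(** If X is strictly convex, two points at distance 2 have a single common
point at distance 1 from both, their midpoint. If Y is not strictly convex,
there are unit vectors x <> y of Y with |x + y| = 2, and then x and y are two
such points for the pair 0, x + y. So the six distances between 0, x, y and
x + y cannot be reproduced in X, and K4 is not flattenable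
([complete4_not_flattenable]). Since flattenability passes to minors
([flattenable_minor]), a flattenable graph has no K4 minor; for a contraction,
place the two merged vertices at the same point: their distance 0 forces them to
coincide in X too.

Conversely, a graph with an edge and without K4 minor has a vertex u with one or
two neighbours (Dirac, [low_degree_vertex]). Contract u into a neighbour w: if t
is the other neighbour, then wt becomes an edge, so a placement of the smaller
graph in X, given by induction, already has the right distance between w and t.
It remains to find a point of X at prescribed distances from two given points,
subject to the triangle inequalities, which hold as the distances come from Y.
The intermediate value theorem on a path joining two antipodal points of a
sphere of X provides it, and such a path exists when dim X >= 2
([triangle_exists]).

Dirac's theorem is proved by induction on the number of vertices, in a form that
exempts one vertex a from having low degree: if G has no K4 minor and a is not
isolated, then some non-isolated u <> a has degree at most 2. Suppose that all
non-isolated vertices other than a have degree at least 3. Collapse a connected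
set S of two or more vertices to a point. By induction the collapsed graph has a
vertex of low degree other than the one that is exempted. If S contains a, exempt
the new point: the vertex found is a vertex u of G outside S, and its degree can
only have dropped because two or more of its neighbours lie in S. Four choices
of S give:
- S = {a, v} for a neighbour v of a: some w of degree 3 is adjacent to both a
  and v. Using this twice yields a triangle a, v, w where v and w have degree 3.
- S = {v, w}, with a exempted: v and w have the same third neighbour x. Then a
  and x are not adjacent, as otherwise a, v, w, x is a K4.
- S = {a, v, w}: the vertex found must be x, so x has degree 3, say with
  neighbours v, w, t.
- S = {a, v, w, x}: the vertex found must be t, so t is adjacent to a. Now
  contracting xt makes a, v, w, x a K4. *)

Set Implicit Arguments.
Unset Strict Implicit.

(** * Complete subgraphs as minors *)

Definition nbrs (G : sgraph) (u : G) : {set G} := [set v | adj u v]%SET.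

Notation K4_minor G := (has_minor G (complete 4)).

Lemma has_minor_contract (G H : sgraph) (x y : G) :
  adj x y -> has_minor (contract x y) H -> has_minor G H.
Proof. by move=> xy [K GK KH]; exists K => //; exact: reduces_contract xy GK. Qed.

Lemma has_minor_del_isolated (G H : sgraph) (x : G) :
  (forall u, ~~ adj x u) -> has_minor (del_vertex x) H -> has_minor G H.
Proof. by move=> x0 [K GK KH]; exists K => //; exact: reduces_del_isolated x0 GK. Qed.

Lemma card_del (G : sgraph) (x : G) : #|[the finType of {u : G | u != x}]|.+1 = #|G|.
Proof.
by rewrite card_sig (eq_card (B := predC1 x)) // cardC1 prednK //; apply/card_gt0P; exists x.
Qed.

(** Isolated vertices outside the clique can be deleted, the others contracted
into any neighbour; neither operation destroys the clique. *)
Lemma complete_subgraph_minor n (G : sgraph) (f : 'I_n -> G) :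
  (forall i j, i != j -> adj (f i) (f j)) -> has_minor G (complete n).
Proof.
have [m] := ubnP #|G|; elim: m G f => // m IH G f leGm cf.
have injf : injective f.
  move=> i j fij; apply/eqP; apply: contraT => /cf.
  by rewrite fij adj_irrefl.
have [/existsP[z zf]|] := boolP [exists z : G, [forall i, f i != z]].
  move/forallP in zf.
  pose g i : {u : G | u != z} := exist _ (f i) (zf i).
  have [/existsP[u zu]|] := boolP [exists u, adj z u].
    rewrite adj_sym in zu; apply: (has_minor_contract zu).
    apply: (IH (contract u z) g) => [|i j ij].
      by rewrite -ltnS (leq_trans _ leGm)// ltnS -(card_del z).
    rewrite /adj/= /contract_adj -val_eqE/= (inj_eq injf) ij cf//.
  move=> /existsPn zu; apply: (has_minor_del_isolated zu).
  apply: (IH (del_vertex z) g) => [|i j ij].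
    by rewrite -ltnS (leq_trans _ leGm)// ltnS -(card_del z).
  by rewrite /adj/= /del_vertex_adj/= cf.
move=> /existsPn surjf.
have sf z : exists i, f i == z.
  by have /forallPn[i] := surjf z; rewrite negbK => fi; exists i.
pose g z := xchoose (sf z).
have fK z : f (g z) = z by apply/eqP; exact: (xchooseP (sf z)).
have gK i : g (f i) = i by apply: injf.
exists G; first exact: reduces_refl.
exists g; first by exists f.
move=> u v; rewrite -[LHS]/(g u != g v).
have [->|uv] := eqVneq u v; first by rewrite eqxx adj_irrefl.
have guv : g u != g v by apply: contra uv => /eqP guv; rewrite -[u]fK guv fK.
by rewrite guv -[in RHS](fK u) -[in RHS](fK v) cf.
Qed.

Lemma K4_of_clique (G : sgraph) (a b c d : G) :
  adj a b -> adj a c -> adj a d -> adj b c -> adj b d -> adj c d -> K4_minor G.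
Proof.
move=> ab ac ad bc bd cd.
apply: (@complete_subgraph_minor 4 G (tnth [tuple a; b; c; d])).
by case=> [[|[|[|[|//]]]]] ? [[|[|[|[|//]]]]] ?; rewrite -val_eqE//= => _;
  rewrite /tnth//= 1?adj_sym.
Qed.

(** * Collapsing a connected set of vertices *)

(** [c] is the quotient map of [G] onto the minor [H] in which [S] has become a
single vertex; for nonempty [S], [collapse_card] makes it surjective. *)
Record collapse (G : sgraph) (S : {set G}) (H : sgraph) (c : G -> H) : Prop := {
  collapse_eq : forall u v, (c u == c v) = (u == v) || (u \in S) && (v \in S);
  collapse_adj : forall u v, adj u v -> c u != c v -> adj (c u) (c v);
  collapse_lift : forall h k, adj h k -> exists u v, [/\ c u = h, c v = k & adj u v];
  collapse_card : #|H| + #|S| = #|G|.+1;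
  collapse_minor : forall K, has_minor H K -> has_minor G K }.

(** Connectedness in the form in which it is used: the vertices can be listed so
that each one can be contracted into the union of the previous ones. *)
Inductive connected_set (G : sgraph) : {set G} -> Prop :=
| connected1 x : connected_set [set x]%SET
| connectedU S x y : connected_set S -> x \in S -> y \notin S -> adj x y ->
    connected_set (y |: S)%SET.

Lemma collapse_edge (G : sgraph) (x y : G) : adj x y ->
  exists c : G -> contract x y, collapse [set x; y]%SET c.
Proof.
move=> xy.
have xNy : x != y by apply: contraTneq xy => ->; rewrite adj_irrefl.
pose k (u : G) : contract x y := insubd (exist _ x xNy : {u : G | u != y}) u.
have kE u : val (k u) = if u == y then x else u.
  by rewrite /k val_insubd; case: eqVneq.
have kV (h : contract x y) : k (val h) = h.
  by apply/val_inj; rewrite kE (negPf (valP h)).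
exists k; split => [u v|u v uv kuv|h h' hh'||K].
- rewrite -val_eqE !kE !inE; case: (eqVneq u y) => [->|uy]; case: (eqVneq v y) => [->|vy] //=.
  + by rewrite eqxx.
  + by rewrite orbT orbF eq_sym.
  + by rewrite (negPf uy) !orbT andbT orbF.
  + rewrite !orbF; case: (eqVneq u x) => [->|] //=; last by rewrite orbF.
    by rewrite [x == v]eq_sym; case: (v == x).
- rewrite /adj/= /contract_adj kuv/= !kE.
  move: uv; case: (eqVneq u y) => [->|uy]; case: (eqVneq v y) => [->|vy].
  + by rewrite adj_irrefl.
  + by rewrite eqxx => ->; rewrite orbT.
  + by rewrite eqxx => ->; rewrite !orbT.
  + by move=> ->.
- have kx : k y = k x by apply/val_inj; rewrite !kE eqxx (negPf xNy).
  move: hh'; rewrite /adj/= /contract_adj => /andP[_ /or3P[|/andP[/eqP hx]|/andP[/eqP hx]]] e.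
  + by exists (val h), (val h').
  + by exists y, (val h'); rewrite kx -hx !kV.
  + by exists (val h), y; rewrite kx -hx !kV.
- by rewrite cards2 xNy addn2 -(card_del y).
- exact: has_minor_contract.
Qed.

Lemma collapse_comp (G H K : sgraph) (S : {set G}) (c : G -> H) (x y : G) (d : H -> K) :
  x \in S -> y \notin S ->
  collapse S c -> collapse [set c x; c y]%SET d -> collapse (y |: S)%SET (d \o c).
Proof.
move=> xS yS cS dS.
have cE u : (c u == c x) = (u \in S).
  by rewrite (collapse_eq cS) xS andbT; case: eqVneq => // ->.
have cyE u : (c u == c y) = (u == y).
  by rewrite (collapse_eq cS) (negPf yS) andbF orbF.
split => [u v|u v uv /= duv|h h' hh'||L].
- rewrite /= (collapse_eq dS) !inE !cE !cyE (collapse_eq cS).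
  do !case: eqVneq => //= ?; subst; rewrite ?(negPf yS) ?orbT ?orbF ?andbT ?andbF //=.
  by rewrite orbb.
- apply: (collapse_adj dS) => //; apply: (collapse_adj cS) => //.
  by apply: contra duv => /eqP ->.
- have [w [w' [<- <- ww']]] := collapse_lift dS hh'.
  have [u [u' [<- <- uu']]] := collapse_lift cS ww'.
  by exists u, u'.
- have := collapse_card dS; have := collapse_card cS; rewrite cards2 cardsU1 yS.
  by rewrite [c x == _]eq_sym cE yS/=; lia.
- by move=> /(collapse_minor dS)/(collapse_minor cS).
Qed.

Lemma collapse_exists (G : sgraph) (S : {set G}) : connected_set S ->
  exists (H : sgraph) (c : G -> H), collapse S c.
Proof.
elim=> [x|{}S x y _ [H [c cS]] xS yS xy].
  exists G, id; split => //.
  - move=> u v; rewrite !inE; case: (eqVneq u x) => [->|]; rewrite ?orbF//=.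
    by rewrite [v == x]eq_sym orbb.
  - by move=> h k hk; exists h, k.
  - by rewrite cards1 addn1.
have cxy : adj (c x) (c y).
  apply: (collapse_adj cS) => //; rewrite (collapse_eq cS) (negPf yS) andbF orbF.
  by apply: contraNneq yS => <-.
have [d dS] := collapse_edge cxy.
by exists (contract (c x) (c y)), (d \o c); exact: collapse_comp cS dS.
Qed.

(** The neighbours of [u] in [S] are merged into one, the others are kept. *)
Lemma collapse_deg_out (G H : sgraph) (S : {set G}) (c : G -> H) (u : G) :
  collapse S c -> u \notin S ->
  #|(nbrs u :\: S)%SET| + (nbrs u :&: S != set0)%SET <= #|nbrs (c u)|.
Proof.
move=> cS uS.
have cN v : v \in nbrs u -> c v \in nbrs (c u).
  rewrite !inE => uv; apply: (collapse_adj cS) => //.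
  rewrite (collapse_eq cS) (negPf uS) orbF.
  by apply: contraTneq uv => ->; rewrite adj_irrefl.
(* R keeps a single representative of the neighbours of u in S. *)
suff [R [RN cR RS]] : exists R : {set G}, [/\ (R \subset nbrs u)%SET,
    {in R &, injective c} &
    #|(nbrs u :\: S)%SET| + (nbrs u :&: S != set0)%SET = #|R|].
  rewrite RS -(card_in_imset cR); apply: subset_leq_card.
  by apply/fintype.subsetP => _ /imsetP[v vR ->]; apply: cN; exact: (fintype.subsetP RN).
have [->|[s]] := set_0Vmem (nbrs u :&: S)%SET.
  exists (nbrs u :\: S)%SET; rewrite subsetDl eqxx addn0; split=> // v w.
  by rewrite !inE => /andP[/negPf vS _] _ /eqP; rewrite (collapse_eq cS) vS orbF => /eqP.
rewrite finset.inE => /andP[sN sS]; exists (s |: (nbrs u :\: S))%SET; split.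
- by rewrite subUset sub1set sN subsetDl.
- move=> v w; rewrite !inE => vR wR /eqP; rewrite (collapse_eq cS) => /orP[/eqP//|/andP[vS wS]].
  by move: vR wR; rewrite vS wS/= !orbF => /eqP-> /eqP->.
- rewrite cardsU1 inE sS/= addnC; congr (_ + _); apply/eqP; rewrite eqb1.
  by apply/set0Pn; exists s; rewrite inE sN.
Qed.

Lemma collapse_deg_in (G H : sgraph) (S : {set G}) (c : G -> H) (u : G) :
  collapse S c -> u \in S ->
  #|((\bigcup_(s in S) nbrs s) :\: S)%SET| <= #|nbrs (c u)|.
Proof.
move=> cS uS.
rewrite -(card_in_imset (f := c)); last first.
  move=> v w; rewrite !inE => /andP[/negPf vS _] _ /eqP.
  by rewrite (collapse_eq cS) vS orbF => /eqP.
apply: subset_leq_card; apply/fintype.subsetP => _ /imsetP[v + ->].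
rewrite !inE => /andP[vS /bigcupP[s sS]]; rewrite inE => sv.
have /eqP <- : c s == c u by rewrite (collapse_eq cS) uS sS orbT.
apply: (collapse_adj cS) => //; rewrite (collapse_eq cS) (negPf vS) andbF orbF.
by apply: contraNneq vS => <-.
Qed.
(** * Vertices of low degree *)

Lemma card3_third (T : finType) (A : {set T}) (p q : T) :
  #|A| = 3 -> p \in A -> q \in A -> p != q ->
  exists r, [/\ r != p, r != q & A = [set p; q; r]%SET].
Proof.
move=> A3 pA qA pq.
have : #|(A :\ p :\ q)%SET| = 1.
  have := cardsD1 p A; have := cardsD1 q (A :\ p)%SET.
  by rewrite !inE pA qA eq_sym pq A3/=; lia.
move/eqP/cards1P => [r rE].
have /setD1P[rq /setD1P[rp rA]] : r \in (A :\ p :\ q)%SET by rewrite rE inE.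
exists r; split => //; apply/esym/eqP; rewrite eqEcard A3 !cardsU !cards1.
have -> : ([set p] :&: [set q] = set0)%SET.
  by apply/setP => z; rewrite !inE; case: eqVneq => // ->; rewrite (negPf pq).
have -> : ([set p; q] :&: [set r] = set0)%SET.
  apply/setP => z; rewrite !inE [z == r]eq_sym.
  by do !case: eqVneq => //= ?; subst; rewrite ?eqxx in rp rq.
rewrite cards0 andbT; apply/fintype.subsetP => z; rewrite !inE.
by move=> /orP[/orP[]|] /eqP->.
Qed.

Lemma sub2_card (T : finType) (A : {set T}) (p q : T) :
  (A \subset [set p; q])%SET -> 1 < #|A| -> p \in A /\ q \in A.
Proof.
move=> sA A2; suff -> : A = [set p; q]%SET by rewrite !inE !eqxx orbT.
by apply/eqP; rewrite eqEcard sA cards2; case: (p == q) => //=; lia.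
Qed.

Lemma nbrs_sym (G : sgraph) (u v : G) : (u \in nbrs v) = (v \in nbrs u).
Proof. by rewrite !inE adj_sym. Qed.

Lemma adj_neq (G : sgraph) (u v : G) : adj u v -> u != v.
Proof. by apply: contraTneq => ->; rewrite adj_irrefl. Qed.

(** Dirac's theorem on K4 minors. Exempting the vertex [a] is what makes the
induction work: a collapse lowers the degrees around the collapsed set, and
the exemption is moved to wherever it helps. *)
Lemma low_degree_vertex (G : sgraph) (a b : G) :
  adj a b -> ~ K4_minor G ->
  exists u v, [/\ u != a, adj u v & #|nbrs u| <= 2].
Proof.
have [m] := ubnP #|G|; elim: m G a b => // m IH G a b leGm ab K4free.
have [//|nolow] := pselect (exists u v : G, [/\ u != a, adj u v & #|nbrs u| <= 2]).
exfalso.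
have deg3 u v : u != a -> adj u v -> 2 < #|nbrs u|.
  by move=> ua uv; rewrite ltnNge; apply/negP => u2; apply: nolow; exists u, v.
(* The induction hypothesis for G / S with the class of a exempted, stated in G:
   p represents that class, and pq is an edge that survives. The second
   alternative is that the vertex of low degree is S itself. *)
have quot (S : {set G}) p q : connected_set S -> 1 < #|S| -> adj p q ->
    (p == a) || (p \in S) && (a \in S) -> ~~ ((p \in S) && (q \in S)) ->
    (exists u, [/\ u \notin S, u != a, 2 < #|nbrs u|, 1 < #|(nbrs u :&: S)%SET| &
                   #|(nbrs u :\: S)%SET| <= 1]) \/
    (a \notin S) && (#|((\bigcup_(s in S) nbrs s) :\: S)%SET| <= 2).
  move=> /collapse_exists[H [c cS]] S2 pq paS pqS.
  have cpa : c p = c a by apply/eqP; rewrite (collapse_eq cS).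
  have cpq : adj (c p) (c q).
    apply: (collapse_adj cS) => //; rewrite (collapse_eq cS) (negPf pqS) orbF.
    exact: adj_neq.
  have HG : #|H| < m by have := collapse_card cS; lia.
  have [|h [k [hp hk h2]]] := IH H _ _ HG cpq.
    by move=> /(collapse_minor cS).
  have [u' [v [uh vk uv]]] := collapse_lift cS hk.
  rewrite -uh in hp h2; rewrite cpa (collapse_eq cS) negb_or in hp.
  case/andP: hp => ua uaS.
  have [uS|uS] := boolP (u' \in S).
    right; move: uaS; rewrite uS/= => -> /=.
    exact: leq_trans (collapse_deg_in cS uS) h2.
  left; exists u'; have d := deg3 _ _ ua uv.
  have := leq_trans (collapse_deg_out cS uS) h2; rewrite -card_gt0.
  have : #|(nbrs u' :&: S)%SET| + #|(nbrs u' :\: S)%SET| = #|nbrs u'| by exact: cardsID.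
  move: #|(nbrs u' :&: S)%SET| #|(nbrs u' :\: S)%SET| d => i j d dE ij.
  suff : (1 < i) && (j <= 1) by case/andP; split.
  by case: i dE ij => [|i] /=; lia.
have partner v : adj a v -> exists w, [/\ adj a w, adj v w & #|nbrs w| = 3].
  move=> av; have va : v != a by rewrite eq_sym adj_neq.
  have [q qv qa] : exists2 q, adj v q & q != a.
    have : 0 < #|(nbrs v :\ a)%SET|.
      have d := deg3 v a va (etrans (adj_sym v a) av).
      by have := cardsD1 a (nbrs v); lia.
    by move=> /card_gt0P[q]; rewrite !inE => /andP[]; exists q.
  have [|||||[u [uS ua u3 /sub2_card uS2 uS1]]|] := quot [set v; a]%SET v q.
  - by apply: (@connectedU G _ a) (connected1 a) _ _ av; rewrite !inE.
  - by rewrite cards2 va.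
  - by [].
  - by rewrite !inE !eqxx !orbT.
  - by rewrite !inE eqxx (negPf qa) orbF/= eq_sym adj_neq.
  - have [] := uS2 _ _ (subsetIr _ _).
    rewrite !inE => /andP[uv _] /andP[ua' _]; exists u; split; rewrite 1?adj_sym//.
    apply/eqP; rewrite eqn_leq u3 andbT -(cardsID [set v; a]%SET (nbrs u)).
    apply: (@leq_add _ _ 2 1) _ uS1; apply: leq_trans (subset_leq_card (subsetIr _ _)) _.
    by rewrite cards2 va.
  - by rewrite !inE eqxx orbT.
(* Applied to w0, partner gives a w of degree 3; applied again, to w, it gives v. *)
have [w0 [aw0 _ _]] := partner _ ab.
have [w [aw _ w3]] := partner _ aw0.
have [v [av wv v3]] := partner _ aw.
have vw : adj v w by rewrite adj_sym.
have va : adj v a by rewrite adj_sym.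
have wa : adj w a by rewrite adj_sym.
have nva := adj_neq va; have nwa := adj_neq wa; have nvw := adj_neq vw.
have inN (p q : G) : adj p q -> q \in nbrs p by rewrite inE.
have [x [xa xv Nw]] := card3_third w3 (inN _ _ wa) (inN _ _ wv) (adj_neq av).
have [y [ya yw Nv]] := card3_third v3 (inN _ _ va) (inN _ _ vw) (adj_neq aw).
have wx : adj w x by have : x \in nbrs w; [rewrite Nw !inE eqxx !orbT|rewrite inE].
have vy : adj v y by have : y \in nbrs v; [rewrite Nv !inE eqxx !orbT|rewrite inE].
have nwx := adj_neq wx; have nvy := adj_neq vy.
have Evw : connected_set [set v; w].
  by apply: (@connectedU G _ w) (connected1 w) _ _ wv; rewrite !inE.
(* Otherwise vw contracts to a vertex with the three neighbours a, x, y. *)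
have xy : x = y.
  apply/eqP; apply: contraT => nxy.
  have [|||||[u [uS ua u3 /sub2_card uS2 uS1]]|] := quot [set v; w]%SET a v.
  - exact: Evw.
  - by rewrite cards2 nvw.
  - by [].
  - by rewrite eqxx.
  - by rewrite !inE ![a == _]eq_sym (negPf nva) (negPf nwa).
  - have [] := uS2 _ _ (subsetIr _ _).
    rewrite !inE => /andP[uv _] /andP[uw _].
    have : u \in nbrs v by rewrite inE adj_sym.
    have : u \in nbrs w by rewrite inE adj_sym.
    move: uS; rewrite Nv Nw !inE (negPf ua) negb_or => /andP[/negPf-> /negPf->]/=.
    by move=> /eqP ux /eqP uy; rewrite -ux uy eqxx in nxy.
  - move=> /andP[_]; rewrite leqNgt => /negP[].
    apply: (@leq_trans #|[set a; x; y]%SET|).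
      rewrite !cardsU !cards1.
      have -> : ([set a] :&: [set x] = set0)%SET.
        by apply/setP => z; rewrite !inE; case: eqVneq => // ->; rewrite eq_sym (negPf xa).
      have -> : ([set a; x] :&: [set y] = set0)%SET.
        apply/setP => z; rewrite !inE [z == y]eq_sym.
        by do !case: eqVneq => //= ?; subst; rewrite ?eqxx in ya nxy.
      by rewrite cards0.
    apply: subset_leq_card; apply/fintype.subsetP => z; rewrite !inE.
    move=> /orP[/orP[]|] /eqP->.
    + rewrite ![a == _]eq_sym (negPf nva) (negPf nwa)/=.
      by apply/bigcupP; exists v; rewrite !inE ?eqxx.
    + rewrite (negPf xv) eq_sym (negPf nwx)/=.
      by apply/bigcupP; exists w; rewrite !inE ?eqxx ?orbT.
    + rewrite (negPf yw) eq_sym (negPf nvy)/=.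
      by apply/bigcupP; exists v; rewrite !inE ?eqxx.
subst y.
have nax : ~~ adj a x.
  by apply/negP => ax; apply: K4free; exact: (@K4_of_clique G a v w x).
pose S3 := (v |: (w |: [set a]))%SET.
have S3conn : connected_set S3.
  apply: (@connectedU G _ a) => //; last by rewrite !inE negb_or nvw nva.
    by apply: (@connectedU G _ a) => //; [exact: connected1|rewrite !inE|rewrite !inE].
  by rewrite !inE eqxx orbT.
have S3card : #|S3| = 3.
  by rewrite /S3 !cardsU1 cards1 !inE negb_or nvw nva nwa.
have aS3 : a \in S3 by rewrite !inE eqxx !orbT.
have vS3 : v \in S3 by rewrite !inE eqxx.
have wS3 : w \in S3 by rewrite !inE eqxx !orbT.
have xS3 : x \notin S3 by rewrite !inE !negb_or xv xa eq_sym nwx.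
have NvS3 z : z \in nbrs v -> z \notin S3 -> z = x.
  by rewrite Nv !inE => /orP[/orP[]|] /eqP-> //; rewrite eqxx ?orbT.
have NwS3 z : z \in nbrs w -> z \notin S3 -> z = x.
  by rewrite Nw !inE => /orP[/orP[]|] /eqP-> //; rewrite eqxx ?orbT.
have [t [tv tw Nx]] : exists t, [/\ t != v, t != w & nbrs x = [set v; w; t]%SET].
  apply: card3_third => //; try by rewrite inE adj_sym.
  have [|||||[u [uS ua u3 u2 u1]]|] := quot S3 v x; rewrite ?S3card ?aS3 ?vS3 ?(negPf xS3)//.
    by rewrite orbT.
  (* a alone does not account for two neighbours of u in S3. *)
  have ux : u = x.
    have [uNv|uNv] := boolP (u \in nbrs v); first exact: NvS3.
    have [uNw|uNw] := boolP (u \in nbrs w); first exact: NwS3.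
    suff /subset_leq_card : (nbrs u :&: S3 \subset [set a])%SET by rewrite cards1 leqNgt u2.
    apply/fintype.subsetP => z; rewrite !inE => /andP[uz /or3P[] /eqP zE]; subst z.
    + by rewrite inE adj_sym uz in uNv.
    + by rewrite inE adj_sym uz in uNw.
    + by rewrite eqxx.
  subst u.
  have : (nbrs x :&: S3 \subset [set v; w])%SET.
    apply/fintype.subsetP => z; rewrite !inE => /andP[xz /or3P[] /eqP zE]; subst z.
    + by rewrite eqxx.
    + by rewrite eqxx orbT.
    + by rewrite adj_sym (negPf nax) in xz.
  move=> /subset_leq_card; rewrite cards2 nvw => s2.
  by apply/eqP; rewrite eqn_leq u3 andbT -(cardsID S3 (nbrs x)) (@leq_add _ _ 2 1 s2 u1).
have xt : adj x t by have : t \in nbrs x; [rewrite Nx !inE eqxx !orbT|rewrite inE].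
have ta : t != a by apply: contraNneq nax => <-; rewrite adj_sym.
pose S4 := (x |: S3)%SET.
have [|||||[u [uS ua u3 u2 u1]]|] := quot S4 x t.
- by apply: (@connectedU G _ v).
- by rewrite cardsU1 xS3 S3card.
- by [].
- by rewrite !inE !eqxx !orbT.
- by rewrite !inE !negb_and !negb_or tv tw ta [t == x]eq_sym (adj_neq xt) orbT.
- have [ux uS3] : u != x /\ u \notin S3 by apply/andP; rewrite -negb_or -in_setU1.
  have uNv : u \notin nbrs v by apply: contra ux => /NvS3 ->.
  have uNw : u \notin nbrs w by apply: contra ux => /NwS3 ->.
  have [|ua' ux'] := sub2_card (p := a) (q := x) _ u2.
    apply/fintype.subsetP => z; rewrite !inE => /andP[uz /or4P[] /eqP zE]; subst z.
    + by rewrite eqxx orbT.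
    + by rewrite inE adj_sym uz in uNv.
    + by rewrite inE adj_sym uz in uNw.
    + by rewrite eqxx.
  move: ua' ux'; rewrite !finset.inE => /andP[ua' _] /andP[xu _].
  have ut : u = t.
    have : u \in nbrs x by rewrite nbrs_sym inE.
    rewrite Nx !inE => /orP[/orP[]|] /eqP // uE; subst u.
      by rewrite vS3 in uS3.
    by rewrite wS3 in uS3.
  subst u.
  (* Merging t into x supplies the missing adjacency between x and a. *)
  have [c cS] := collapse_edge xt.
  apply: K4free; apply: (collapse_minor cS).
  have cadj p q : adj p q -> ~~ ((p \in [set x; t]) && (q \in [set x; t])) ->
      adj (c p) (c q).
    move=> pq npq; apply: (collapse_adj cS) => //.
    by rewrite (collapse_eq cS) (negPf npq) orbF adj_neq.
  have cxt : c x = c t by apply/eqP; rewrite (collapse_eq cS) !inE !eqxx !orbT.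
  have outa : a \notin [set x; t] by rewrite !inE negb_or eq_sym xa eq_sym.
  have outv : v \notin [set x; t] by rewrite !inE negb_or nvy eq_sym.
  have outw : w \notin [set x; t] by rewrite !inE negb_or nwx eq_sym.
  apply: (@K4_of_clique _ (c a) (c v) (c w) (c x)).
  + by apply: cadj => //; rewrite (negPf outa).
  + by apply: cadj => //; rewrite (negPf outa).
  + by rewrite cxt; apply: cadj; [rewrite adj_sym|rewrite (negPf outa)].
  + by apply: cadj => //; rewrite (negPf outv).
  + by apply: cadj => //; rewrite (negPf outv).
  + by apply: cadj => //; rewrite (negPf outw).
- by move=> /andP[/negP[]]; rewrite !inE eqxx !orbT.
Qed.

Import Order.TTheory GRing.Theory Num.Theory.
Import numFieldNormedType.Exports.
Local Open Scope ring_scope.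

(** * Points at prescribed distances *)

Lemma independent_complement (R : realType) (X : normedModType R) (d : X) :
  dim_ge 2 X -> d != 0 ->
  exists e : X, forall s t : R, s *: d + t *: e = 0 -> s = 0 /\ t = 0.
Proof.
move=> [b bfree] d0.
have nomult (e : X) : ~ (exists k : R, e = k *: d) ->
    forall s t : R, s *: d + t *: e = 0 -> s = 0 /\ t = 0.
  move=> ne s t ste.
  have t0 : t = 0.
    apply/eqP; apply: contra_notT ne => t0.
    exists (- s / t); apply: (scalerI t0); rewrite scalerA mulrC divfK// scaleNr.
    by apply/eqP; rewrite -addr_eq0 addrC ste.
  move: ste; rewrite t0 scale0r addr0 => /eqP; rewrite scaler_eq0 (negPf d0) orbF.
  by move=> /eqP.
have [[k0 b0]|] := pselect (exists k : R, b ord0 = k *: d); last first.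
  by move=> /nomult; exists (b ord0).
have [[k1 b1]|] := pselect (exists k : R, b ord_max = k *: d); last first.
  by move=> /nomult; exists (b ord_max).
exfalso.
have dep (c0 c1 : R) : c0 * k0 + c1 * k1 = 0 -> c0 = 0 /\ c1 = 0.
  move=> c01; have := bfree (fun i => if i == ord0 then c0 else c1).
  rewrite big_ord_recl big_ord1/= => /(_ _)cf.
  have {}cf : forall i : 'I_2, (if i == ord0 then c0 else c1) = 0.
    apply: cf; have -> : lift ord0 ord0 = ord_max :> 'I_2 by exact/val_inj.
    by rewrite b0 b1 !scalerA -scalerDl c01 scale0r.
  by split; [exact: (cf ord0)|exact: (cf ord_max)].
have [k1_0 _] : k1 = 0 /\ - k0 = 0 by apply: dep; ring.
have [|_ /eqP] := dep 0 1; first by rewrite k1_0; ring.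
by rewrite oner_eq0.
Qed.

(** The distance to [c *: d] takes the two extreme values [`|a - c|] and
[`|a + c|] at [a *: d] and [- a *: d]; the intermediate value theorem applies
along a path on the sphere joining these points. *)
Lemma sphere_distance (R : realType) (X : normedModType R) (d : X) (a b c : R) :
  dim_ge 2 X -> `|d| = 1 -> 0 <= a -> `|a - c| <= b <= `|a + c| ->
  exists2 r : X, `|r| = a & `|r - c *: d| = b.
Proof.
move=> dimX d1 a0 /andP[ba bb].
have d0 : d != 0 by rewrite -normr_eq0 d1 oner_eq0.
have [e de] := independent_complement dimX d0.
(* g runs from d to - d and, since e is independent of d, never vanishes, so
   that it can be normalised. *)
pose g (t : R) : X := (1 - 2 * t) *: d + (t * (1 - t)) *: e.
have g0 t : g t != 0.
  apply/eqP => /de[t1 t2].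
  have t12 : t = 2^-1 by lra.
  by move: t2; rewrite t12; lra.
pose f (t : R) : R := `|(a / `|g t|) *: g t - c *: d|.
have gc : continuous g.
  move=> t; apply: cvgD; apply: cvgZ; try exact: cvg_cst.
    apply: cvgB; first exact: cvg_cst.
    by apply: cvgM; [exact: cvg_cst|exact: cvg_id].
  apply: cvgM; first exact: cvg_id.
  by apply: cvgB; [exact: cvg_cst|exact: cvg_id].
have fc : continuous f.
  move=> t; apply: cvg_norm; apply: cvgB; last exact: cvg_cst.
  apply: cvgZ; last exact: gc.
  apply: cvgM; first exact: cvg_cst.
  apply: cvgV; first by rewrite normr_eq0.
  by apply: cvg_norm; exact: gc.
have f0 : f 0 = `|a - c|.
  rewrite /f /g mulr0 subr0 scale1r mul0r scale0r addr0 d1 divr1.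
  by rewrite -scalerBl normrZ d1 mulr1.
have f1 : f 1 = `|a + c|.
  have g1 : g 1 = - d by rewrite /g subrr mulr0 scale0r addr0 -[RHS]scaleN1r; congr (_ *: _); ring.
  rewrite /f g1 normrN d1 divr1 scalerN -opprD normrN.
  by rewrite -scalerDl normrZ d1 mulr1.
have [||t _ ft] := @IVT R f 0 1 b (@ler01 R).
- exact: continuous_subspaceT.
- by rewrite f0 f1 ge_min ba/= le_max bb orbT.
exists ((a / `|g t|) *: g t) => //.
by rewrite normrZ normrM normfV normr_id (ger0_norm a0) divfK// normr_eq0.
Qed.

Lemma triangle_exists (R : realType) (X : normedModType R) (p q : X) (a b : R) :
  dim_ge 2 X -> 0 <= a -> `|a - b| <= `|p - q| -> `|p - q| <= a + b ->
  exists r : X, `|p - r| = a /\ `|q - r| = b.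
Proof.
move=> dimX a0 lo hi.
(* If p = q, any unit vector is a possible direction. *)
have [d d1 pq] : exists2 d : X, `|d| = 1 & q - p = `|p - q| *: d.
  have [->|pq] := eqVneq p q.
    have [e efree] := dimX.
    have e0 : e ord0 != 0.
      apply/eqP => e0; have := efree (fun i => (i == ord0)%:R).
      rewrite big_ord_recl big_ord1/= e0 scaler0 scale0r addr0 => /(_ erefl ord0)/eqP.
      by rewrite oner_eq0.
    exists (`|e ord0|^-1 *: e ord0); last by rewrite subrr normr0 scale0r.
    by rewrite normrZ normfV normr_id mulVf// normr_eq0.
  have pq0 : `|p - q| != 0 by rewrite normr_eq0 subr_eq0.
  exists (`|p - q|^-1 *: (q - p)); last by rewrite scalerA mulfV// scale1r.
  by rewrite normrZ normfV normr_id (distrC q) mulVf.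
have [|r ra rb] := sphere_distance dimX d1 a0 (b := b) (c := `|p - q|).
  move: lo hi (normr_ge0 (p - q)); set c := `|p - q|; rewrite ler_norml => /andP[] *.
  by rewrite ler_norml (ger0_norm (_ : 0 <= a + c)); lra.
exists (p + r); rewrite opprD addrA subrr sub0r normrN; split => //.
by rewrite addrA pq -opprB normrN.
Qed.

(** * Flattenability and minors *)

Lemma flattenableP (R : realType) (X Y : normedModType R) (G : sgraph) :
  flattenable X Y G <->
  forall p : G -> Y, exists q : G -> X,
    forall u v, adj u v -> `|q u - q v| = `|p u - p v|.
Proof.
split=> [flat p|flat _ [p _ <-]].
  have [|q _ qp] := flat (measurement p); first by exists p.
  by exists q => u v uv; rewrite -!(measurementE _ uv) qp.
have [q qp] := flat p; exists q => //.
apply/funext => e; apply: qp; rewrite /endpoints.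
by case/andP: (xchooseP (existsP (valP e))).
Qed.

Lemma flattenable_isomorphic (R : realType) (X Y : normedModType R) (G H : sgraph) :
  isomorphic G H -> flattenable X Y G -> flattenable X Y H.
Proof.
move=> [f [g fK gK] fadj] /flattenableP flat; apply/flattenableP => p.
have [q qp] := flat (p \o f); exists (q \o g) => u v uv /=.
by rewrite qp /= ?gK// -fadj !gK.
Qed.

(** A placement of the smaller graph extends to the larger one: edge deletion
keeps the vertices, a deleted isolated vertex can go anywhere, and the two ends
of a contracted edge go to the same point. *)
Lemma flattenable_reduces (R : realType) (X Y : normedModType R) (G H : sgraph) :
  reduces G H -> flattenable X Y G -> flattenable X Y H.
Proof.
elim=> [//|{}G {}H x y xy _ IH|{}G {}H x y xy _ IH|{}G {}H x x0 _ IH];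
  move=> /flattenableP flat; apply: IH; apply/flattenableP => p.
- by have [q qp] := flat p; exists q => u v /andP[uv _]; exact: qp.
- have xNy := adj_neq xy.
  pose k (u : G) : contract x y := insubd (exist _ x xNy : {u : G | u != y}) u.
  have kV (h : contract x y) : k (val h) = h.
    by apply/val_inj; rewrite val_insubd (valP h).
  have kxy : k x = k y by apply/val_inj; rewrite !val_insubd eqxx xNy.
  have [q qp] := flat (p \o k).
  have qxy : q x = q y.
    by apply/eqP; rewrite -subr_eq0 -normr_eq0 qp//= kxy subrr normr0.
  exists (q \o val) => u v /andP[_ /or3P[uv|/andP[/eqP ux yv]|/andP[/eqP vx uy]]] /=.
  + by rewrite qp//= !kV.
  + by rewrite ux qxy qp//= -kxy -ux !kV.
  + by rewrite vx qxy qp//= -kxy -vx !kV.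
- have [q qp] := flat (fun u => if insub u is Some h then p h else 0).
  by exists (q \o val) => u v uv; rewrite /= qp//= !valK.
Qed.

Lemma flattenable_minor (R : realType) (X Y : normedModType R) (G H : sgraph) :
  has_minor G H -> flattenable X Y G -> flattenable X Y H.
Proof.
by move=> [K GK KH] /(flattenable_reduces GK); exact: flattenable_isomorphic.
Qed.

(** The unit vectors [p - z] and [z - q] have a sum of norm 2, so they are equal:
[z] is the midpoint. *)
Lemma unit_midpoint_unique (R : realType) (X : normedModType R) (p q m n : X) :
  strictly_convex X -> `|p - q| = 2 ->
  `|p - m| = 1 -> `|q - m| = 1 -> `|p - n| = 1 -> `|q - n| = 1 -> m = n.
Proof.
move=> strictX pq.
have mid z : `|p - z| = 1 -> `|q - z| = 1 -> 2 *: z = p + q.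
  move=> pz qz; have /(strictX _ _ pz) [+ _] : `|z - q| = 1 by rewrite distrC.
  rewrite addrA subrK => /(_ pq) e.
  by rewrite scaler_nat mulr2n -{1}[z](subrK q) -e -addrA addrCA addrNK addrC.
move=> /mid pm /pm em /mid pn /pn en.
by apply: (@scalerI _ _ (2 : R)); rewrite ?pnatr_eq0// em en.
Qed.

(** The distances between the points 0, x, y, x + y, where x and y contradict strict
convexity, would give two midpoints in X. *)
Lemma complete4_not_flattenable (R : realType) (X Y : normedModType R) :
  strictly_convex X -> ~ strictly_convex Y -> ~ flattenable X Y (complete 4).
Proof.
move=> strictX nstrictY /flattenableP flat; apply: nstrictY => x y x1 y1.
split=> [xy2|<-]; last by rewrite -mulr2n -scaler_nat normrZ x1 mulr1 normr_nat.
have [q qp] := flat (tnth [tuple 0; x; y; x + y]).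
have {}qp i j : (i != j :> 'I_4) -> `|q i - q j| = _ := qp i j.
pose o k : 'I_4 := inord k.
have oE k : (k < 4)%N -> val (o k) = k by move=> ?; rewrite /o /= inordK.
have no i j : (i < 4)%N -> (j < 4)%N -> i != j -> o i != o j.
  by move=> ? ? ?; rewrite -val_eqE !oE.
have e12 : q (o 1) = q (o 2).
  apply: (unit_midpoint_unique (p := q (o 0)) (q := q (o 3)) strictX);
    rewrite qp ?no// !(tnth_nth 0) !oE//=.
  - by rewrite sub0r normrN.
  - by rewrite sub0r normrN.
  - by rewrite addrC addKr.
  - by rewrite sub0r normrN.
  - by rewrite addrK.
have := qp (o 1) (o 2); rewrite e12 subrr normr0 no// => /(_ erefl)/esym/normr0_eq0.
by rewrite !(tnth_nth 0) !oE//= => /subr0_eq.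
Qed.

(** * Flattening graphs without K4 minor *)

Lemma flattenable_of_no_K4_minor (R : realType) (X Y : normedModType R) (G : sgraph) :
  dim_ge 2 X -> ~ has_minor G (complete 4) -> flattenable X Y G.
Proof.
move=> dimX K4free; apply/flattenableP.
have [m] := ubnP #|G|; elim: m G K4free => // m IH G K4free leGm p.
have [[a [b ab]]|noedge] := pselect (has_edge G); last first.
  by exists (fun=> 0) => u v uv; exfalso; apply: noedge; exists u, v.
have [u [w [_ uw u2]]] := low_degree_vertex ab K4free.
have wu : adj w u by rewrite adj_sym.
have nuw := adj_neq uw.
(* If w is the only neighbour of u, then t = w. *)
have [t ut Nu] : exists2 t, adj u t & forall z, adj u z -> z = w \/ z = t.
  have [N0|[t]] := set_0Vmem (nbrs u :\ w)%SET.
    exists w => // z uz; left; apply/eqP; apply: contraT => zw.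
    have : z \in (nbrs u :\ w)%SET by rewrite !finset.inE zw.
    by rewrite N0 finset.inE.
  rewrite !finset.inE => /andP[tw ut]; exists t => // z uz.
  have [->|zw] := eqVneq z w; first by left.
  have [->|zt] := eqVneq z t; first by right.
  exfalso; move: u2; rewrite leqNgt => /negP[].
  rewrite (cardsD1 w) (cardsD1 t) (cardsD1 z) !finset.inE.
  by rewrite uw tw ut zw zt uz.
have uw' : w != u by rewrite eq_sym.
have ut' : t != u by rewrite eq_sym adj_neq.
pose w' : contract w u := exist _ w uw'.
pose t' : contract w u := exist _ t ut'.
have [||q qp] := IH (contract w u) _ _ (p \o val).
- by move=> /(has_minor_contract wu).
- by rewrite -ltnS (leq_trans _ leGm)// ltnS -(card_del u).
have qwt : `|q w' - q t'| = `|p w - p t|.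
  have [wt|wt] := eqVneq w t.
    have -> : w' = t' by exact/val_inj.
    by rewrite wt !subrr !normr0.
  by apply: (qp w' t'); rewrite /adj /= /contract_adj -val_eqE /= wt eqxx ut orbT.
have [|||r [rw rt]] := @triangle_exists R X (q w') (q t') `|p w - p u| `|p t - p u| dimX.
- by [].
- by rewrite qwt (le_trans (ler_dist_dist _ _))// opprB addrA subrK.
- by rewrite qwt (distrC (p t)) ler_distD.
pose f v : X := if insub v is Some h then q h else r.
have fV (h : contract w u) : f (val h) = q h by rewrite /f valK.
have fu : f u = r by rewrite /f insubF ?eqxx.
have fN z : adj u z -> `|f z - f u| = `|p z - p u|.
  by move=> /Nu[] ->; rewrite fu; [rewrite (fV w')|rewrite (fV t')].
exists f => x y; have [->|xu] := eqVneq x u.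
  by move=> /fN; rewrite distrC (distrC (p y)).
have [->|yu] := eqVneq y u; first by rewrite adj_sym => /fN.
move=> xy; rewrite (fV (exist _ x xu)) (fV (exist _ y yu)) qp//.
rewrite /adj /= /contract_adj -val_eqE /= xy andbT.
exact: adj_neq.
Qed.

Theorem theorem6p7 (R : realType) (X Y : normedModType R)
    (strictX : strictly_convex X) (dimX : dim_ge 2 X)
    (dimY : dim_ge 1 Y) (nstrictY : ~ strictly_convex Y)
    (G : sgraph) (edgeG : has_edge G) :
  flattenable X Y G <-> ~ has_minor G (complete 4).
Proof.
split=> [flatG K4|]; last exact: flattenable_of_no_K4_minor.
exact: complete4_not_flattenable (flattenable_minor K4 flatG).
Qed.
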